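(* Let $\mathbb{F}$ be a division ring, $n$ a positive integer, $\sigma:\mathbb{F}\to\mathbb{F}^{n\times n}$ a ring morphism, $\delta:\mathbb{F}\to\mathbb{F}^n$ a $\sigma$-derivation, and $\mathbf{a},\mathbf{b}\in\mathbb{F}^n$. If $\mathbb{F}[\mathcal{D}_{\mathbf{a}}]=\mathbb{F}[\mathcal{D}_{\mathbf{b}}]$, then $K_{\mathbf{a}}=K_{\mathbf{b}}$. Conversely, if $K_{\mathbf{a}}=K_{\mathbf{b}}$ and $K_{\mathbf{a}}\subseteq\mathbb{F}$ is finite (i.e. $\mathbb{F}$ has finite right dimension over $K_{\mathbf{a}}$), then $\mathbb{F}[\mathcal{D}_{\mathbf{a}}]=\mathbb{F}[\mathcal{D}_{\mathbf{b}}]$.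
   Context: Rings are associative with identity, not necessarily commutative, and ring morphisms preserve identities. $\mathbb{F}^n$ denotes column vectors. A map $\delta:\mathbb{F}\to\mathbb{F}^n$ is a $\sigma$-derivation if $\delta(a+b)=\delta(a)+\delta(b)$ and $\delta(ab)=\sigma(a)\delta(b)+\delta(a)b$ for all $a,b\in\mathbb{F}$. Linearized polynomials: let $\mathcal{M}$ be the free monoid on variables $x_1,\dots,x_n$. For $\mathbf{a}\in\mathbb{F}^n$ define $\mathcal{D}_{\mathbf{a}}:\mathbb{F}\to\mathbb{F}^n$ by $\mathcal{D}_{\mathbf{a}}(\beta)=\sigma(\beta)\mathbf{a}+\delta(\beta)$. Define maps $\mathcal{D}_{\mathbf{a}}^{\mathfrak{m}}:\mathbb{F}\to\mathbb{F}$ for $\mathfrak{m}\in\mathcal{M}$ recursively by $\mathcal{D}_{\mathbf{a}}^{1}=\mathrm{Id}$ and $\mathcal{D}_{\mathbf{a}}^{x_i\mathfrak{m}}(\beta)=$ the $i$-th component of $\mathcal{D}_{\mathbf{a}}(\mathcal{D}_{\mathbf{a}}^{\mathfrak{m}}(\beta))$. $\mathbb{F}[\mathcal{D}_{\mathbf{a}}]$ is the left $\mathbb{F}$-vector space of maps $\mathbb{F}\to\mathbb{F}$ generated by $\{\mathcal{D}_{\mathbf{a}}^{\mathfrak{m}}\mid\mathfrak{m}\in\mathcal{M}\}$; equalities between such spaces are equalities of sets of maps $\mathbb{F}\to\mathbb{F}$. Centralizer: $K_{\mathbf{a}}=\{\beta\in\mathbb{F}\mid\mathcal{D}_{\mathbf{a}}(\beta)=\mathbf{a}\beta\}$,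 a division subring of $\mathbb{F}$. *)

(* Defs.v *)
From HB Require Import structures.
From mathcomp Require Import all_boot all_algebra.
From mathcomp Require Import boolp classical_sets.

Set Implicit Arguments.
Unset Strict Implicit.
Unset Printing Implicit Defensive.

Import GRing.Theory.
Local Open Scope classical_set_scope.
Local Open Scope ring_scope.

(* [unitRingType] is not assumed commutative and has 1 != 0. *)
Definition division_ring (F : unitRingType) : Prop :=
  forall x : F, x != 0 -> x \is a GRing.unit.

(* Scalars act on column vectors on the right; ['cV[F]_n] carries only the
   left action [*:], which differs when F is not commutative. *)
Definition rscale (F : unitRingType) (n : nat) (v : 'cV[F]_n) (b : F) :
    'cV[F]_n :=
  \col_(i < n) (v i 0 * b).

Definition is_derivation (F : unitRingType) (n : nat)
    (sigma : F -> 'M[F]_n) (delta : F -> 'cV[F]_n) : Prop :=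
  (forall a b : F, delta (a + b) = delta a + delta b) /\
  (forall a b : F, delta (a * b) = sigma a *m delta b + rscale (delta a) b).

Definition Dop (F : unitRingType) (n : nat)
    (sigma : F -> 'M[F]_n) (delta : F -> 'cV[F]_n) (a : 'cV[F]_n)
    (beta : F) : 'cV[F]_n :=
  sigma beta *m a + delta beta.

(* The free monoid on x_1, ..., x_n is [seq 'I_n], with [i :: m] standing for
   the word x_i m. *)
Fixpoint Dword (F : unitRingType) (n : nat)
    (sigma : F -> 'M[F]_n) (delta : F -> 'cV[F]_n) (a : 'cV[F]_n)
    (m : seq 'I_n) (beta : F) : F :=
  if m is i :: m' then
    Dop sigma delta a (Dword sigma delta a m' beta) i 0
  else beta.

Definition left_span (F : unitRingType) (S : set (F -> F)) : set (F -> F) :=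
  [set f | exists (r : nat) (c : 'I_r -> F) (g : 'I_r -> (F -> F)),
     (forall j, S (g j)) /\
     f = (fun beta => \sum_(j < r) c j * g j beta)].

Definition linpoly (F : unitRingType) (n : nat)
    (sigma : F -> 'M[F]_n) (delta : F -> 'cV[F]_n) (a : 'cV[F]_n) :
    set (F -> F) :=
  left_span [set Dword sigma delta a m | m in [set: seq 'I_n]].

Definition centralizer (F : unitRingType) (n : nat)
    (sigma : F -> 'M[F]_n) (delta : F -> 'cV[F]_n) (a : 'cV[F]_n) : set F :=
  [set beta | Dop sigma delta a beta = rscale a beta].

Definition right_basis (F : unitRingType) (K : set F) (r : nat)
    (e : 'I_r -> F) : Prop :=
  (forall k : 'I_r -> F, (forall i, K (k i)) ->
     \sum_(i < r) e i * k i = 0 -> forall i, k i = 0) /\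
  (forall x : F, exists k : 'I_r -> F,
     (forall i, K (k i)) /\ x = \sum_(i < r) e i * k i).

Definition finite_right_dim (F : unitRingType) (K : set F) : Prop :=
  exists (r : nat) (e : 'I_r -> F), right_basis K e.

(* Main.v *)
(** Both spaces of linearized polynomials are rings of right-linear maps for
    the centralizer: [K_a] consists of the [g] such that every element of
    [F[D_a]] is right-linear with respect to [g].  If [F] has finite right
    dimension over [K_a], a Jacobson density argument shows conversely that
    [F[D_a]] is the ring of all right [K_a]-linear maps, since [F] is a simple
    [F[D_a]]-module whose endomorphisms are the right multiplications by
    elements of [K_a].  Hence [F[D_a]] and [K_a] determine each other. *)
Require Import Defs.
From HB Require Import structures.
From mathcomp Require Import all_boot all_algebra.
From mathcomp Require Import boolp classical_sets.

Import GRing.Theory.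
Local Open Scope classical_set_scope.
Local Open Scope ring_scope.

(** * Closure properties of left spans of maps *)

Section LeftSpan.

Set Implicit Arguments.
Unset Strict Implicit.

Context (F : unitRingType) (S : set (F -> F)).

Lemma left_span_gen g : S g -> left_span S g.
Proof.
move=> Sg; exists 1%N, (fun=> 1), (fun=> g); split=> //.
by apply/funext => x; rewrite big_ord1 mul1r.
Qed.

Lemma left_span0 : left_span S (fun=> 0).
Proof.
exists 0%N, (fun=> 0), (fun=> id); split; first by case.
by apply/funext => x; rewrite big_ord0.
Qed.

Lemma left_spanD f g : left_span S f -> left_span S g ->
  left_span S (fun x => f x + g x).
Proof.
move=> [r [c [u [Su ->]]]] [s [d [v [Sv ->]]]].
exists (r + s)%N.
exists (fun j => match split j with inl i => c i | inr i => d i end).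
exists (fun j => match split j with inl i => u i | inr i => v i end).
split; first by move=> j; case: (split j).
apply/funext => x; rewrite big_split_ord /=; congr (_ + _).
  by apply: eq_bigr => i _; rewrite (unsplitK (inl i)).
by apply: eq_bigr => i _; rewrite (unsplitK (inr i)).
Qed.

Lemma left_spanZ c f : left_span S f -> left_span S (fun x => c * f x).
Proof.
move=> [r [d [u [Su ->]]]]; exists r, (fun j => c * d j), u; split=> //.
by apply/funext => x; rewrite mulr_sumr; under eq_bigr do rewrite mulrA.
Qed.

Lemma left_span_sum r (u : 'I_r -> F -> F) : (forall j, left_span S (u j)) ->
  left_span S (fun x => \sum_(j < r) u j x).
Proof.
elim: r u => [|r IHr] u Su.
  by under eq_fun do rewrite big_ord0; exact: left_span0.
under eq_fun do rewrite big_ord_recr /=.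
by apply: left_spanD => //; apply: IHr.
Qed.

Lemma left_spanBZ f c g : left_span S f -> left_span S g ->
  left_span S (fun x => f x - c * g x).
Proof.
by move=> Sf Sg; under eq_fun do rewrite -mulNr; exact/left_spanD/left_spanZ.
Qed.

End LeftSpan.

(** * The operators [D a] and right linearity over [K a] *)

Section Linpoly.

Set Implicit Arguments.
Unset Strict Implicit.

Context (F : unitRingType) (n : nat) (sigma : {rmorphism F -> 'M[F]_n})
  (delta : F -> 'cV[F]_n) (hdelta : is_derivation sigma delta).

Local Notation D := (Dop sigma delta).
Local Notation K := (centralizer sigma delta).
Local Notation L := (linpoly sigma delta).

Lemma DopD a x y : D a (x + y) = D a x + D a y.
Proof. by rewrite /Dop rmorphD mulmxDl hdelta.1 addrACA. Qed.

Lemma Dop0 a : D a 0 = 0.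
Proof. by apply: (addrI (D a 0)); rewrite -DopD !addr0. Qed.

Lemma Dop_sum a r (u : 'I_r -> F) : D a (\sum_j u j) = \sum_j D a (u j).
Proof. by apply: (big_morph _ (@DopD a) (Dop0 a)). Qed.

Lemma DopM a x y : D a (x * y) = sigma x *m D a y + rscale (delta x) y.
Proof. by rewrite /Dop rmorphM hdelta.2 mulmxDr mulmxA addrA. Qed.

Lemma Dop1 a : D a 1 = a.
Proof.
have d1 : delta 1 = 0.
  apply: (addrI (delta 1)); rewrite addr0 -[in RHS](mulr1 1) hdelta.2.
  rewrite rmorph1 mul1mx; congr (_ + _).
  by apply/colP => i; rewrite mxE mulr1.
by rewrite /Dop rmorph1 mul1mx d1 addr0.
Qed.

(** In the product rule, membership in [K a] replaces [D a g] by [rscale a g], so that [g] factors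
    out on the right. *)
Lemma DopMr a g x i : K a g -> D a (x * g) i 0 = D a x i 0 * g.
Proof.
move=> Kg; rewrite DopM Kg /Dop !mxE mulrDl mulr_suml; congr (_ + _).
by apply: eq_bigr => j _; rewrite mxE mulrA.
Qed.

Lemma centralizer0 a : K a 0.
Proof.
by rewrite /centralizer /= Dop0; apply/colP => i; rewrite !mxE mulr0.
Qed.

Lemma centralizerP a g : (forall i, D a g i 0 = a i 0 * g) -> K a g.
Proof. by move=> Dg; apply/colP => i; rewrite Dg mxE. Qed.

Lemma linpoly_word a m : L a (Dword sigma delta a m).
Proof. by apply: left_span_gen; exists m. Qed.

Lemma linpolyD a f x y : L a f -> f (x + y) = f x + f y.
Proof.
move=> [r [c [u [Su ->]]]]; rewrite -big_split /=; apply: eq_bigr => j _.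
rewrite -mulrDr; congr (_ * _); case: (Su j) => m _ <-.
by elim: m => //= i m ->; rewrite DopD mxE.
Qed.

Lemma linpolyMr a f x g : L a f -> K a g -> f (x * g) = f x * g.
Proof.
move=> [r [c [u [Su ->]]]] Kg; rewrite mulr_suml; apply: eq_bigr => j _.
rewrite -mulrA; congr (_ * _); case: (Su j) => m _ <-.
by elim: m => //= i m ->; rewrite DopMr.
Qed.

(** The product rule moves [D a] past a left coefficient [c]: entries of [sigma c] multiply words
    longer by one letter, and [delta c] multiplies the old word. *)
Lemma linpoly_Dop a f i : L a f -> L a (fun x => D a (f x) i 0).
Proof.
move=> [r [c [u [Su ->]]]]; under eq_fun do rewrite Dop_sum summxE.
apply: left_span_sum => j; under [X in left_span _ X]eq_fun do rewrite DopM !mxE.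
case: (Su j) => m _ <-; apply: left_spanD.
  apply: left_span_sum => k; apply: left_spanZ.
  exact: linpoly_word a (k :: m).
exact/left_spanZ/linpoly_word.
Qed.

(** The one-letter words of [b] lie in [L a], hence are right [K a]-linear; evaluating them at
    [1 * g] and using [D b 1 = b] gives the equation defining [K b]. *)
Lemma linpoly_sub_centralizer a b : L b `<=` L a -> K a `<=` K b.
Proof.
move=> Lba g Kg; apply: centralizerP => i.
have La := Lba _ (linpoly_word b [:: i]).
by have /= := linpolyMr 1 La Kg; rewrite mul1r Dop1.
Qed.

(** * Density and its consequences over a division ring *)

Hypothesis hF : division_ring F.

(** Jacobson density, by induction on [s]: a point killed by every annihilator of the [e j] is a
    right [K a]-combination of them. *)
Lemma linpoly_density a (I : eqType) (e : I -> F) (s : seq I) (x : F) :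
  uniq s ->
  (forall f, L a f -> (forall j, j \in s -> f (e j) = 0) -> f x = 0) ->
  exists k : I -> F, (forall j, K a (k j)) /\ x = \sum_(j <- s) e j * k j.
Proof.
elim: s x => [|i s IHs] x /=.
  (* The empty word is the identity map, so [x] is 0. *)
  move=> _ /(_ _ (linpoly_word a [::])) /= -> //.
  by exists (fun=> 0); split=> [_|]; [exact: centralizer0 | rewrite big_nil].
move=> /andP[s'i us] killx.
(* Given such a [g], the induction hypothesis applies to [x - e i * g]. *)
suff [g Kg killg] : exists2 g, K a g &
    forall f, L a f -> (forall j, j \in s -> f (e j) = 0) -> f x = f (e i) * g.
  have [f Lf f0|k [Kk xk]] := IHs (x - e i * g) us.
    rewrite -mulrN1; apply: (addIr (f (e i * g))).
    by rewrite -(linpolyD _ _ Lf) mulrN1 subrK add0r (linpolyMr _ Lf Kg) killg.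
  exists (fun j => if j == i then g else k j); split=> [j|]; first by case: eqP.
  rewrite big_cons eqxx -[LHS](subrK (e i * g)) xk addrC; congr (_ + _).
  apply: eq_big_seq => j sj; case: eqP => // ji.
  by move: s'i; rewrite -ji sj.
have [kill|] := pselect (forall f, L a f ->
    (forall j, j \in s -> f (e j) = 0) -> f (e i) = 0).
  exists 0 => [|f Lf f0]; first exact: centralizer0.
  rewrite mulr0; apply: killx => // j.
  by rewrite inE => /predU1P[->|]; [exact: kill | exact: f0].
move=> /existsNP[f /not_implyP[Lf /not_implyP[f0 /eqP fi]]].
(* Among the maps killing the tail, [h] is normalized to be 1 at [e i]. Subtracting [u (e i) * h]
   from another such map [u] kills [e i] too, hence [x]. *)
pose h x := (f (e i))^-1 * f x.
have Lh : L a h by exact: left_spanZ.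
have h0 j : j \in s -> h (e j) = 0 by move=> sj; rewrite /h (f0 j) // mulr0.
have hi : h (e i) = 1 by rewrite /h mulVr // hF.
have kill u : L a u -> (forall j, j \in s -> u (e j) = 0) ->
    u x = u (e i) * h x.
  move=> Lu u0; apply/eqP; rewrite -subr_eq0; apply/eqP.
  apply: (killx (fun y => u y - u (e i) * h y)); first exact: left_spanBZ.
  move=> j; rewrite inE => /predU1P[->|sj]; first by rewrite hi mulr1 subrr.
  by rewrite (u0 j) // h0 // mulr0 subr0.
(* Applying [kill] to the components of [D a] after [h], whose values at [e i] are those of
   [D a 1 = a], shows that [h x] lies in [K a]. *)
exists (h x) => //; apply: centralizerP => k.
rewrite (kill (fun y => D a (h y) k 0)) ?hi ?Dop1 //; first exact: linpoly_Dop.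
by move=> j sj; rewrite h0 // Dop0 mxE.
Qed.

(** If every map killing the other basis vectors killed [e i], density would make [e i] a
    combination of them, against freeness. Otherwise some map can be rescaled to be 1 at [e i]. *)
Lemma linpoly_dual_basis a r (e : 'I_r -> F) (i : 'I_r) :
  right_basis (K a) e ->
  exists2 f, L a f & forall j, f (e j) = (j == i)%:R.
Proof.
move=> [free_e _]; pose s := [seq j <- enum 'I_r | j != i].
have us : uniq s by rewrite filter_uniq ?enum_uniq.
have sE j : (j \in s) = (j != i).
  by rewrite mem_filter mem_enum andbT.
have [kill|] := pselect (forall f, L a f ->
    (forall j, j \in s -> f (e j) = 0) -> f (e i) = 0).
  have [k [Kk ik]] := linpoly_density us kill.
  pose k' j := if j == i then -1 else k j.
  have Kk' j : K a (k' j).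
    rewrite /k'; case: eqP => // _; apply: centralizerP => l.
    have := DopD a 1 (-1); rewrite subrr Dop0 Dop1 => /colP/(_ l).
    by rewrite !mxE mulrN1 => /esym/eqP; rewrite addrC addr_eq0 => /eqP.
  have /free_e-/(_ Kk' i) : \sum_(j < r) e j * k' j = 0.
    rewrite (bigD1 i) //= {1}/k' eqxx mulrN1 {1}ik big_filter big_enum_cond.
    rewrite [X in _ + X](eq_bigr (fun j => e j * k j)) ?addNr // => j ji.
    by rewrite /k' (negPf ji).
  by rewrite /k' eqxx => /eqP; rewrite oppr_eq0 oner_eq0.
move=> /existsNP[f /not_implyP[Lf /not_implyP[f0 /eqP fi]]].
exists (fun x => (f (e i))^-1 * f x) => [|j]; first exact: left_spanZ.
have [->|ji] := eqVneq; first by rewrite mulVr // hF.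
by rewrite (f0 j) ?sE // mulr0.
Qed.

(** A map in [L b] is right [K b]-linear, hence right [K a]-linear, so its values on a basis
    determine it as a left combination of the dual maps in [L a]. *)
Lemma centralizer_sub_linpoly a b : finite_right_dim (K a) ->
  K a `<=` K b -> L b `<=` L a.
Proof.
move=> [r [e be]] Kab h Lh.
have [u Lu uE] : exists2 u : 'I_r -> F -> F, forall i, L a (u i) &
    forall i j, u i (e j) = (j == i)%:R.
  have /choice[u uP] : forall i, exists f,
      L a f /\ forall j, f (e j) = (j == i)%:R.
    by move=> i; have [f Lf fE] := linpoly_dual_basis i be; exists f.
  by exists u => i; have [] := uP i.
have linear_sum c f k : L c f -> (forall i, K c (k i)) ->
    f (\sum_i e i * k i) = \sum_i f (e i) * k i.
  move=> Lf Kk; under [RHS]eq_bigr do rewrite -(linpolyMr _ Lf) //.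
  apply: (big_morph f (fun x y => linpolyD x y Lf)).
  by apply: (addrI (f 0)); rewrite -(linpolyD _ _ Lf) !addr0.
suff -> : h = fun x => \sum_i h (e i) * u i x.
  by apply: left_span_sum => i; exact/left_spanZ/Lu.
apply/funext => x; have [k [Kk ->]] := be.2 x.
rewrite (linear_sum b) => [|//|i]; last exact: Kab.
apply: eq_bigr => i _; congr (_ * _).
rewrite (linear_sum a) // (bigD1 i) //= uE eqxx mul1r big1 ?addr0 // => j ji.
by rewrite uE (negPf ji) mul0r.
Qed.

End Linpoly.

Theorem theorem12 (F : unitRingType) (hF : division_ring F)
    (n : nat) (hn : (0 < n)%N)
    (sigma : {rmorphism F -> 'M[F]_n})
    (delta : F -> 'cV[F]_n) (hdelta : is_derivation sigma delta)
    (a b : 'cV[F]_n) :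
  (linpoly sigma delta a = linpoly sigma delta b ->
     centralizer sigma delta a = centralizer sigma delta b) /\
  (centralizer sigma delta a = centralizer sigma delta b ->
     finite_right_dim (centralizer sigma delta a) ->
     linpoly sigma delta a = linpoly sigma delta b).
Proof.
split=> [Lab|Kab dimK]; apply/seteqP; split.
- by apply: linpoly_sub_centralizer => //; rewrite Lab.
- by apply: linpoly_sub_centralizer => //; rewrite Lab.
(* Here the roles of [a] and [b] are exchanged; the equality of centralizers transports finiteness
   to [b]. *)
- by apply: centralizer_sub_linpoly => //; rewrite -Kab.
- by apply: centralizer_sub_linpoly => //; rewrite Kab.
Qed.
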